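(* Let $A=\{(x,y): x,y\in\mathbb{Z}_{\geq 0}^2,\ \det(x\ y)=1\}$ be the set of ordered pairs of lattice vectors in the closed first quadrant spanning a parallelogram of oriented area one. Then $$4\sum_{(x,y)\in A}\frac{1}{|x|^2\,|y|^2\,|x+y|^2}=\pi.$$
   Context: For $x,y\in\mathbb{R}^2$, $(x\ y)$ denotes the $2\times 2$ matrix with columns $x$ and $y$, and $|\cdot|$ is the Euclidean norm on $\mathbb{R}^2$. *)

(* Defs.v *)
From HB Require Import structures.
From mathcomp Require Import all_boot all_order all_algebra.
From mathcomp Require Import all_classical all_reals all_analysis.

Set Implicit Arguments.
Unset Strict Implicit.
Unset Printing Implicit Defensive.

Import Order.TTheory GRing.Theory Num.Theory.

Local Open Scope classical_set_scope.
Local Open Scope ring_scope.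

(* The library's norm on matrices is the sup norm, hence this definition. *)
Definition enorm (R : realType) (n : nat) (v : 'cV[R]_n) : R :=
  Num.sqrt (\sum_(i < n) v i 0 ^+ 2).

Definition toR (R : realType) (n : nat) (v : 'cV[int]_n) : 'cV[R]_n :=
  map_mx intr v.

Definition A : set ('cV[int]_2 * 'cV[int]_2) :=
  [set p : 'cV[int]_2 * 'cV[int]_2 | [/\ forall i, 0 <= p.1 i 0,
               forall i, 0 <= p.2 i 0 &
               \det (row_mx p.1 p.2 : 'M[int]_2) = 1]].

(* Main.v *)
Require Import Defs.
From HB Require Import structures.
From mathcomp Require Import all_boot all_order all_algebra.
From mathcomp Require Import all_classical all_reals all_analysis.
From mathcomp Require Import ring lra zify.

Import Order.TTheory GRing.Theory Num.Theory.

Local Open Scope classical_set_scope.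
Local Open Scope ring_scope.

(** The pairs in [A] are the nodes of the binary tree with root (e1, e2) in
    which (x, y) has the children (x, x + y) and (x + y, y).  Put c = x . y;
    since |x|^2 |y|^2 = c^2 + 1, the angle t between x and y is
    arccot c and c / (c^2 + 1) = sin t cos t.  The angle of a node is the sum
    of the angles of its children, whereas sin t cos t grows by
    2 / (|x|^2 |y|^2 |x + y|^2) when a node is replaced by its children.  Hence
    t - sin t cos t, which is pi / 2 at the root, decreases by twice the summand
    in each such step, and summing down to depth n leaves as remainder the sum
    of t - sin t cos t over the nodes of depth n.  There c >= n, hence
    0 <= t - sin t cos t <= t / (n + 1), and the remainder is at most
    (pi / 2) / (n + 1). *)

(** * The binary tree of unimodular pairs *)

Definition ladd (x y : nat * nat) : nat * nat := ((x.1 + y.1)%N, (x.2 + y.2)%N).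

Definition ldot (v : (nat * nat) * (nat * nat)) : nat :=
  (v.1.1 * v.2.1 + v.1.2 * v.2.2)%N.

Definition lnorm2 (x : nat * nat) : nat := (x.1 ^ 2 + x.2 ^ 2)%N.

(** The determinant condition with its negative term moved across, so that it makes sense over
    [nat]. *)
Definition unimodular (v : (nat * nat) * (nat * nat)) : Prop :=
  (v.1.1 * v.2.2 = v.1.2 * v.2.1 + 1)%N.

Definition child (v : (nat * nat) * (nat * nat)) (b : bool) :=
  if b then (v.1, ladd v.1 v.2) else (ladd v.1 v.2, v.2).

Definition root : (nat * nat) * (nat * nat) := ((1%N, 0%N), (0%N, 1%N)).

Lemma unimodular_child v b : unimodular v -> unimodular (child v b).
Proof. by case: v b => [[p q] [r s]] []; rewrite /unimodular /=; nia. Qed.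

Lemma unimodular_foldl v w : unimodular v -> unimodular (foldl child v w).
Proof. by elim: w v => //= b w IH v /(unimodular_child v b) /IH. Qed.

(** Unimodularity makes both coordinates of the sum of the columns positive, while each column of
    [root] contains a zero. *)
Lemma child_neq_root v b : unimodular v -> child v b <> root.
Proof.
by case: v b => [[p q] [r s]] []; rewrite /unimodular /root /ladd /= => uv [];
  nia.
Qed.

(** If the letters differed, two columns, one from each parent, would add up to zero, which
    unimodularity forbids. *)
Lemma child_inj v v' b b' : unimodular v -> unimodular v' ->
  child v b = child v' b' -> v = v' /\ b = b'.
Proof.
case: v v' b b' => [[p q] [r s]] [[p' q'] [r' s']] [] [];
  rewrite /unimodular /child /ladd /= => uv uv' []; try nia.
- by move=> -> -> /addnI -> /addnI ->.
- by move=> e1 e2 e3 e4; split=> //; congr ((_, _), (_, _)); lia.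
Qed.

Lemma foldl_child_inj : injective (foldl child root).
Proof.
have u w : unimodular (foldl child root w) by exact: unimodular_foldl.
elim/last_ind => [|w b IH] w'; case/lastP: w' => [//|w' b'].
- by rewrite foldl_rcons /= => /esym /child_neq_root; case.
- by rewrite foldl_rcons /= => /child_neq_root; case.
- by rewrite !foldl_rcons => /child_inj [] // /IH -> ->.
Qed.

(** A subtractive Euclidean step: away from [root] one column dominates the other coordinatewise,
    and the smaller is subtracted from the larger. *)
Lemma unimodular_parent v : unimodular v -> v <> root ->
  exists2 u, unimodular u & exists b, v = child u b.
Proof.
case: v => [[p q] [r s]]; rewrite /unimodular /root /= => uv vr.
have [rp|pr] := ltnP r p.
  have sq : (s <= q)%N.
    rewrite leqNgt; apply/negP => qs; apply: vr.
    (* This gives [(r + 1) * (q + 1) <= q * r + 1], which leaves only [r = q = 0]. *)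
    have := leq_mul rp qs; rewrite uv => h.
    have r0 : r = 0%N by lia.
    have q0 : q = 0%N by lia.
    move: uv; rewrite r0 q0 muln0 => /eqP; rewrite muln_eq1.
    by move=> /andP[/eqP -> /eqP ->].
  exists ((p - r, q - s), (r, s))%N; first by rewrite /=; nia.
  by exists false; rewrite /child /ladd /= !subnK// ltnW.
have qs : (q <= s)%N by nia.
exists ((p, q), (r - p, s - q))%N; first by rewrite /=; nia.
by exists true; rewrite /child /ladd /= !subnKC.
Qed.

(** Descent on the sum of the four entries, which drops at the parent because no column of a
    unimodular pair is zero. *)
Lemma foldl_child_surj v : unimodular v -> exists w, foldl child root w = v.
Proof.
have [n] := ubnP (v.1.1 + v.1.2 + v.2.1 + v.2.2)%N.
elim: n v => // n IH v vn uv.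
have [->|/eqP vr] := eqVneq v root; first by exists [::].
have [u uu [b vE]] := unimodular_parent v uv vr.
have [|w wE] := IH u _ uu; last by exists (rcons w b); rewrite foldl_rcons wE.
by move: u b uu vE vn => [[p q] [r s]] [] /= uu -> /=; move: uu;
  rewrite /unimodular /=; nia.
Qed.

(** * The angle and its gap as functions of the dot product *)

Section Arccot.
Variable R : realType.
Implicit Types a b c : R.

Definition arccot c : R := pi / 2 - atan c.

(* With t = arccot c this is t - sin t cos t. *)
Definition gap c : R := arccot c - c / (c ^+ 2 + 1).

Lemma cos_atan_gt0 c : 0 < cos (atan c).
Proof. by apply: cos_gt0_pihalf; rewrite atan_gtNpi2 atan_ltpi2. Qed.

Lemma sin_atan c : sin (atan c) = c * cos (atan c).
Proof. by rewrite -{2}[c]atanK /tan divfK// gt_eqF// cos_atan_gt0. Qed.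

Lemma atan_gt0 c : 0 < c -> 0 < atan c.
Proof. by rewrite -{2}(@atan0 R) => /lt_atan. Qed.

Lemma arccot0 : arccot 0 = pi / 2.
Proof. by rewrite /arccot atan0 subr0. Qed.

Lemma arccot_ge0 c : 0 <= arccot c.
Proof. by rewrite subr_ge0 ltW// atan_ltpi2. Qed.

Lemma arccotE c : 0 < c -> arccot c = atan c^-1.
Proof.
move=> c0; have := atan_gt0 c c0; have := atan_ltpi2 c.
have pi0 := @pi_gt0 R => h1 h2.
apply: tan_inj; rewrite ?in_itv/= ?atan_gtNpi2 ?atan_ltpi2 ?atanK//.
  by rewrite /arccot; apply/andP; split; lra.
rewrite /arccot -opprB tanN /tan cosBpihalf sinBpihalf sin_atan.
have := cos_atan_gt0 c; set k := cos _ => k0.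
by field; rewrite !gt_eqF.
Qed.

(** By the mean value theorem for [atan] on [[0, 1/c]], the angle is [1/c] times a value of the
    derivative, which lies between its value at [1/c] and 1. *)
Lemma arccot_bounds c : 0 < c -> c / (c ^+ 2 + 1) <= arccot c <= c^-1.
Proof.
move=> c0; rewrite arccotE//.
have ci : 0 < c^-1 by rewrite invr_gt0.
have [|x] := @MVT R atan (fun x => (1 + x ^+ 2)^-1) 0 c^-1 ci.
  by apply: derivable_within_continuous => z _; exact: derivable_atan.
rewrite in_itv/= atan0 !subr0 => /andP[x0 xc] ->.
have xc2 : x ^+ 2 <= c^-1 ^+ 2 by rewrite ler_pXn2r ?nnegrE ?ltW.
have x2 : 0 <= x ^+ 2 by rewrite sqr_ge0.
apply/andP; split.
  have -> : c / (c ^+ 2 + 1) = (1 + c^-1 ^+ 2)^-1 * c^-1.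
    by field; rewrite (gt_eqF c0) /= gt_eqF//; nra.
  rewrite ler_pM2r// lef_pV2 ?posrE; lra.
by rewrite ler_piMl ?(ltW ci)// invf_le1; lra.
Qed.

Lemma gap0 : gap 0 = pi / 2.
Proof. by rewrite /gap arccot0 mul0r subr0. Qed.

Lemma gap_ge0 c : 0 <= c -> 0 <= gap c.
Proof.
rewrite le_eqVlt => /predU1P[<-|c0]; last first.
  by rewrite /gap subr_ge0; case/andP: (arccot_bounds c c0).
by rewrite gap0 divr_ge0// pi_ge0.
Qed.

Lemma gap_le c : 0 <= c -> gap c <= arccot c / (c ^+ 2 + 1).
Proof.
move=> c0; have k0 : 0 < c ^+ 2 + 1 by have := sqr_ge0 c; lra.
rewrite /gap ler_pdivlMr// mulrBl divfK ?gt_eqF//.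
(* Clearing the denominator reduces the claim to [c * arccot c <= 1], up to a factor [c]. *)
suff : c * (c * arccot c) <= c * 1 by nra.
apply: ler_wpM2l => //.
move: c0; rewrite le_eqVlt => /predU1P[<-|c0]; first by rewrite mul0r ler01.
by rewrite -ler_pdivlMl// mulr1; case/andP: (arccot_bounds c c0).
Qed.

(** For [a = |x|^2], [b = |y|^2] and [c = x . y], the arguments [c + a] and [c + b] are the dot
    products of the two children; the identity is the addition formula for the tangent. *)
Lemma arccotD a b c : 0 < a -> 0 < b -> 0 <= c -> a * b = c ^+ 2 + 1 ->
  arccot c = arccot (c + a) + arccot (c + b).
Proof.
move=> a0 b0 c0 abc; rewrite /arccot.
(* In this form both sides lie in [(-pi/2, pi/2)], where [tan] is injective. *)
suff : atan c = atan (c + a) + atan (c + b) - pi / 2 by lra.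
have := atan_gt0 (c + a); have := atan_gt0 (c + b).
have := atan_ltpi2 (c + a); have := atan_ltpi2 (c + b).
move=> ? ? /(_ (ltr_wpDl _ _)) A /(_ (ltr_wpDl _ _)) B.
have {}A := A c0 b0; have {}B := B c0 a0.
apply: tan_inj; rewrite ?in_itv/= ?atan_gtNpi2 ?atan_ltpi2 ?atanK//.
  by apply/andP; split; lra.
rewrite /tan cosBpihalf sinBpihalf sinD cosD !sin_atan.
have := cos_atan_gt0 (c + a); have := cos_atan_gt0 (c + b).
set k := cos _ => k0; set l := cos _ => l0.
have D : (c + a) * (c + b) - 1 = c * ((c + a) + (c + b)).
  by rewrite mulrDl !mulrDr abc; ring.
transitivity ((((c + a) * (c + b) - 1) * (k * l)) /
              (((c + a) + (c + b)) * (k * l))); last first.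
  by congr (_ / _); ring.
rewrite D; field; rewrite !gt_eqF//; lra.
Qed.

Lemma gap_split a b c : 0 < a -> 0 < b -> 0 <= c -> a * b = c ^+ 2 + 1 ->
  gap c = gap (c + a) + gap (c + b) + 2 * (a * b * (a + b + 2 * c))^-1.
Proof.
move=> a0 b0 c0 abc; rewrite /gap (arccotD a b c)// -abc.
have -> : (c + a) ^+ 2 + 1 = a * (a + b + 2 * c).
  rewrite !mulrDr abc; ring.
have -> : (c + b) ^+ 2 + 1 = b * (a + b + 2 * c).
  rewrite !mulrDr [b * a]mulrC abc; ring.
have s0 : 0 < a + b + 2 * c by lra.
suff : (c + a) / (a * (a + b + 2 * c)) + (c + b) / (b * (a + b + 2 * c))
     = c / (a * b) + 2 * (a * b * (a + b + 2 * c))^-1 by lra.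
(* Inserting the factor [a * b - c ^+ 2 = 1] turns the goal into an identity of rational functions,
   within reach of [field]. *)
have -> : 2 * (a * b * (a + b + 2 * c))^-1
        = 2 * (a * b - c ^+ 2) * (a * b * (a + b + 2 * c))^-1.
  by rewrite abc; congr (_ * _); ring.
by field; rewrite !gt_eqF.
Qed.

End Arccot.

(** * Summation over the tree *)

Section Tree.
Variable R : realType.
Local Notation lpair := ((nat * nat) * (nat * nat))%type.
Implicit Types v : lpair.

Definition term v : R :=
  (lnorm2 v.1 * lnorm2 v.2 * lnorm2 (ladd v.1 v.2))%:R^-1.

(** Letters are prepended because [foldl] reads from the left: the head selects the subtree, so a
    sum over [words] splits along the two children. *)
Fixpoint words (n : nat) : seq (seq bool) :=
  if n is m.+1 then
    [::] :: map (cons true) (words m) ++ map (cons false) (words m)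
  else [::].

Lemma mem_words n w : (w \in words n) = (size w < n)%N.
Proof.
elim: n w => //= n IH [//|b w].
rewrite inE /= mem_cat ltnS -IH.
have inj c : injective (cons c : seq bool -> _) by move=> ? ? [].
have ninj c u : (c :: w \in map (cons (~~ c)) u) = false.
  by apply/negP => /mapP[? _ []]; case: c.
by case: b; rewrite (mem_map (inj _)) ?(ninj true) ?(ninj false) ?orbF.
Qed.

Lemma words_uniq n : uniq (words n).
Proof.
elim: n => //= n IH; rewrite mem_cat negb_or cat_uniq.
rewrite !map_inj_uniq ?IH /=; do ?by move=> ? ? [].
rewrite andbT -!andbA; apply/and3P; split.
- by apply/negP => /mapP[].
- by apply/negP => /mapP[].
- by apply/hasPn => _ /mapP[w _ ->]; apply/negP => /mapP[? _ []].
Qed.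

Definition tree_sum n v : R := \sum_(w <- words n) term (foldl child v w).

Lemma tree_sumS n v : tree_sum n.+1 v =
  term v + (tree_sum n (child v true) + tree_sum n (child v false)).
Proof. by rewrite /tree_sum /= big_cons big_cat !big_map. Qed.

Lemma lnorm2_gt0 v : unimodular v -> (0 < lnorm2 v.1)%N /\ (0 < lnorm2 v.2)%N.
Proof.
by case: v => [[p q] [r s]]; rewrite /unimodular /lnorm2 /=; split; nia.
Qed.

Lemma ldot_child v b :
  ldot (child v b) = (ldot v + lnorm2 (if b then v.1 else v.2))%N.
Proof.
by case: v b => [[p q] [r s]] []; rewrite /ldot /lnorm2 /ladd /=; ring.
Qed.

Lemma lnorm2D v :
  lnorm2 (ladd v.1 v.2) = (lnorm2 v.1 + lnorm2 v.2 + 2 * ldot v)%N.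
Proof.
by case: v => [[p q] [r s]]; rewrite /ldot /lnorm2 /ladd /=; ring.
Qed.

(** Lagrange's identity, with determinant 1. *)
Lemma lnorm2M v : unimodular v ->
  (lnorm2 v.1 * lnorm2 v.2 = ldot v ^ 2 + 1)%N.
Proof.
by case: v => [[p q] [r s]]; rewrite /unimodular /ldot /lnorm2 /=; nia.
Qed.

Local Notation c_ v := ((ldot v)%:R : R).

Lemma arccot_child v : unimodular v -> arccot R (c_ v) =
  arccot R (c_ (child v true)) + arccot R (c_ (child v false)).
Proof.
move=> uv; have [a0 b0] := lnorm2_gt0 v uv.
rewrite !ldot_child.
move: (lnorm2 v.1) (lnorm2 v.2) (ldot v) a0 b0 (lnorm2M v uv) => a b c a0 b0 abc.
rewrite !natrD; apply: arccotD; rewrite ?ltr0n//.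
by rewrite -natrM abc natrD natrX.
Qed.

Lemma gap_child v : unimodular v -> gap R (c_ v) =
  gap R (c_ (child v true)) + gap R (c_ (child v false)) + 2 * term v.
Proof.
move=> uv; have [a0 b0] := lnorm2_gt0 v uv.
rewrite !ldot_child /term lnorm2D.
move: (lnorm2 v.1) (lnorm2 v.2) (ldot v) a0 b0 (lnorm2M v uv) => a b c a0 b0 abc.
rewrite !(natrM, natrD); apply: gap_split; rewrite ?ltr0n//.
by rewrite -natrM abc natrD natrX.
Qed.

(** Telescoping [gap_child] leaves a sum of gaps, all nonnegative. *)
Lemma tree_sum_le n v : unimodular v -> 2 * tree_sum n v <= gap R (c_ v).
Proof.
elim: n v => [|n IH] v uv; first by rewrite /tree_sum big_nil mulr0 gap_ge0.
rewrite tree_sumS gap_child//.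
have := IH _ (unimodular_child v true uv).
have := IH _ (unimodular_child v false uv); lra.
Qed.

(** Each step down lowers [n] by one and raises the dot product by at least one, so the denominator
    never shrinks, while the angles of the children add up to that of the parent. *)
Lemma tree_sum_ge n v : unimodular v ->
  gap R (c_ v) - 2 * tree_sum n v <= arccot R (c_ v) / (ldot v + n).+1%:R.
Proof.
elim: n v => [|n IH] v uv.
  rewrite /tree_sum big_nil mulr0 subr0 addn0.
  apply: (le_trans (gap_le _ _ _)) => //.
  apply: ler_wpM2l; first exact: arccot_ge0.
  (* The dot product [c] is a natural number, hence [c + 1 <= c ^ 2 + 1]. *)
  rewrite lef_pV2 ?posrE ?ltr0n// -natrX natr1 ?ltr0n// ler_nat; nia.
have step b : gap R (c_ (child v b)) - 2 * tree_sum n (child v b)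
    <= arccot R (c_ (child v b)) / (ldot v + n.+1).+1%:R.
  apply: (le_trans (IH _ (unimodular_child v b uv))).
  apply: ler_wpM2l; first exact: arccot_ge0.
  rewrite lef_pV2 ?posrE ?ltr0n// ler_nat ldot_child.
  by have [] := lnorm2_gt0 v uv; case: b; lia.
rewrite tree_sumS gap_child// arccot_child// [leRHS]mulrDl.
move: (step true) (step false); set k := (_ + _).+1%:R; by move: k => k; lra.
Qed.

Lemma term_ge0 v : 0 <= term v.
Proof. by rewrite invr_ge0 ler0n. Qed.

Lemma esum_tree : \esum_(w in [set: seq bool]) (term (foldl child root w))%:E
  = (pi / 4)%:E.
Proof.
have uroot : unimodular root by [].
have tE n : (\sum_(w \in [set` words n]) (term (foldl child root w))%:E
    = (tree_sum n root)%:E)%E.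
  by rewrite -fsbig_seq ?words_uniq// sumEFin.
have le4 n : tree_sum n root <= pi / 4.
  have := tree_sum_le n root uroot; rewrite gap0; lra.
have le_pi : (\esum_(w in [set: seq bool]) (term (foldl child root w))%:E
    <= (pi / 4)%:E)%E.
  apply: ge_ereal_sup => _ [X [Xfin _] <-].
  have [n Xn] : exists n, X `<=` [set` words n].
    have /finite_seqP[s ->] := Xfin.
    (* The successor is needed because [words n] holds the lengths strictly below [n]. *)
    exists (\max_(w <- s) size w).+1 => w ws.
    suff : w \in words (\max_(w <- s) size w).+1 by [].
    by rewrite mem_words ltnS; exact: (leq_bigmax_seq _ ws).
  apply: (@le_trans _ _ (tree_sum n root)%:E); last by rewrite lee_fin.
  rewrite -tE; apply: lee_fsum_nneg_subset => //.
  - exact: finite_seq.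
  - by move=> w /set_mem /Xn wn; exact/mem_set.
  - by move=> w _; rewrite lee_fin term_ge0.
have ge_pi n : ((pi / 4 - pi / 4 / n.+1%:R)%:E
    <= \esum_(w in [set: seq bool]) (term (foldl child root w))%:E)%E.
  apply: esum_ge; exists [set` words n]; first by split=> //; exact: finite_seq.
  rewrite tE lee_fin; have := tree_sum_ge n root uroot.
  rewrite gap0 arccot0 add0n; set k := n.+1%:R.
  by move: k => k; lra.
apply/eqP; rewrite eq_le le_pi /=.
(* The upper bound excludes [+oo] and the lower bound at [n = 0] excludes [-oo], so the rest is real
   arithmetic. *)
move: le_pi ge_pi; case: (esum _ _) => [e| |] // _ ge_pi; last first.
  by have := ge_pi 0%N.
rewrite lee_fin; apply/ler_addgt0Pl => eps eps0.
have pi0 := pi_gt0 R.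
have [n nE] : exists n : nat, pi / 4 / eps < n.+1%:R.
  by exists (Num.truncn (pi / 4 / eps)); exact: truncnS_gt.
have := ge_pi n; rewrite lee_fin.
have : pi / 4 / n.+1%:R < eps.
  by rewrite ltr_pdivrMr ?ltr0n// [ltRHS]mulrC -ltr_pdivrMr.
by set k := n.+1%:R; move: k => k; lra.
Qed.

End Tree.

(** * Transfer to the integer columns of [A] *)

Definition to_col (x : nat * nat) : 'cV[int]_2 :=
  \col_i (if i == 0 then x.1 else x.2)%:Z.

Definition to_cols (v : (nat * nat) * (nat * nat)) := (to_col v.1, to_col v.2).

Lemma to_col_inj : injective to_col.
Proof.
move=> [p q] [r s] /colP e; have := e 0; have := e 1.
by rewrite !mxE /= => -[->] [->].
Qed.

Lemma det_mx22 (T : comPzRingType) (M : 'M[T]_2) :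
  \det M = M 0 0 * M 1 1 - M 1 0 * M 0 1.
Proof.
have l0 : lift 0 0 = 1 :> 'I_2 by exact: val_inj.
have l1 : lift 1 0 = 0 :> 'I_2 by exact: val_inj.
rewrite (expand_det_col _ 0) !big_ord_recl big_ord0 addr0.
rewrite /cofactor !det_mx11 !mxE !l0 !l1 /= expr0 expr1.
by rewrite mul1r mulN1r mulrN.
Qed.

Lemma det_cols (x y : 'cV[int]_2) :
  \det (row_mx x y : 'M[int]_2) = x 0 0 * y 1 0 - x 1 0 * y 0 0.
Proof.
have E0 i : (row_mx x y : 'M[int]_2) i 0 = x i 0.
  by rewrite -(row_mxEl x y); congr (row_mx _ _ _ _); exact: val_inj.
have E1 i : (row_mx x y : 'M[int]_2) i 1 = y i 0.
  by rewrite -(row_mxEr x y); congr (row_mx _ _ _ _); exact: val_inj.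
by rewrite det_mx22 !E0 !E1.
Qed.

Lemma enorm_to_col (R : realType) (x : nat * nat) :
  enorm (toR R (to_col x)) ^+ 2 = (lnorm2 x)%:R.
Proof.
rewrite /enorm sqr_sqrtr; last by apply: sumr_ge0 => i _; exact: sqr_ge0.
rewrite !big_ord_recl big_ord0 addr0 !mxE /= /lnorm2 natrD !natrX.
by rewrite -!pmulrn.
Qed.

Lemma to_colD x y : to_col (ladd x y) = to_col x + to_col y.
Proof. by apply/colP => i; rewrite !mxE; case: ifP. Qed.

Lemma to_cols_word_bij :
  set_bij [set: seq bool] A (to_cols \o foldl child root).
Proof.
split.
- move=> w _; have := unimodular_foldl root w erefl.
  rewrite /A /= /to_cols; case: foldl => x y uv; split=> [i|i|] /=.
  + by rewrite mxE; case: ifP.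
  + by rewrite mxE; case: ifP.
  + by rewrite det_cols !mxE /=; move: uv; rewrite /unimodular /=; lia.
- move=> w w' _ _ [/to_col_inj e1 /to_col_inj e2]; apply: foldl_child_inj.
  by rewrite [LHS]surjective_pairing [RHS]surjective_pairing e1 e2.
- move=> [x y] [/= x0 y0]; rewrite det_cols => d.
  (* Taking absolute values loses nothing on columns in the closed first quadrant, so they yield the
     preimage. *)
  have colE (z : 'cV[int]_2) : (forall i, 0 <= z i 0) ->
      to_col (absz (z 0 0), absz (z 1 0)) = z.
    move=> z0; apply/colP => i; rewrite mxE.
    by case: ifPn => [/eqP ->|i0]; rewrite /= gez0_abs//;
      congr (z _ _); apply: val_inj; case: i i0 => [[|[]]].
  have [|w wE] := foldl_child_surj
    ((absz (x 0 0), absz (x 1 0)), (absz (y 0 0), absz (y 1 0))).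
    rewrite /unimodular /=.
    by move: (x0 0) (x0 1) (y0 0) (y0 1) d; lia.
  by exists w => //=; rewrite wE /to_cols /= !colE.
Qed.

Theorem theorem1 (R : realType) :
  ((4 : R)%:E *
   (\esum_(p in A)
      ((enorm (toR R p.1) ^+ 2 * enorm (toR R p.2) ^+ 2
        * enorm (toR R (p.1 + p.2)) ^+ 2)^-1)%:E))%E = (pi : R)%:E.
Proof.
rewrite (reindex_esum _ _ _ _ to_cols_word_bij).
under eq_esum do rewrite /= -to_colD !enorm_to_col -!natrM.
rewrite esum_tree -EFinM; congr EFin; lra.
Qed.
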